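(* Let $G$ be a direct product of finitely many finitely generated free groups and let $N\leq G$ be a finitely presented coabelian subgroup of $G$. Then there is a constant $C>1$ such that the Dehn function of $N$ satisfies $\delta_N(n)\leq C^n$ for all $n$.
   Context: A subgroup $N$ of a group $G$ is called coabelian if it is the kernel of a surjective homomorphism $G\to\mathbb{Z}^m$ for some $m$. Let $H$ be a group with finite presentation $\mathcal{P}=\langle X\mid R\rangle$ and let $F_X$ be the free group on $X$. A word $w$ in $X^{\pm 1}$ is null-homotopic if it represents the trivial element of $H$. Its area $\mathrm{Area}_{\mathcal{P}}(w)$ is the minimal $k$ such that in $F_X$ one has $w=\prod_{i=1}^k u_i r_i u_i^{-1}$ with $r_i\in R^{\pm1}$ and $u_i\in F_X$. The Dehn function of $H$ with respect to $\mathcal{P}$ is $\delta_{H,\mathcal{P}}(n):=\max\{\mathrm{Area}_{\mathcal{P}}(w)\mid w \text{ null-homotopic},\ \ell(w)\leq n\}$, where $\ell(w)$ is the length of $w$. One writes $\delta_H$ for $\delta_{H,\mathcal{P}}$ with respect to a finite presentation; up to the equivalence $f_1\asymp f_2$ (meaning $f_1\preccurlyeq f_2\preccurlyeq f_1$, where $f_1\preccurlyeq f_2$ if there is $C\geq1$ with $f_1(n)\leq Cf_2(Cn+C)+Cn+C$ for all $n$) it does not depend on the finite presentation. *)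

(* Defs.v *)
From HB Require Import structures.
From mathcomp Require Import all_boot all_order all_algebra.
From mathcomp Require Import boolp reals.

Set Implicit Arguments.
Unset Strict Implicit.
Unset Printing Implicit Defensive.

Local Open Scope group_scope.

(* The letter (x, false) stands for x and (x, true) for x^-1. *)
Definition letter (X : Type) : Type := (X * bool)%type.

Definition invl (X : Type) (l : letter X) : letter X := (l.1, ~~ l.2).

Lemma invlK (X : Type) : involutive (@invl X).
Proof. by case=> x b; rewrite /invl /= negbK. Qed.

Section Reduction.
Variable X : choiceType.
Implicit Types (l : letter X) (s t u : seq (letter X)).

Definition reduced s := sorted (fun l l' => l' != invl l) s.

Definition cons_red l s : seq (letter X) :=
  if s is l' :: s' then if l' == invl l then s' else l :: s else [:: l].

Definition reduce s := foldr cons_red [::] s.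

Lemma reduced_behead l s : reduced (l :: s) -> reduced s.
Proof. exact: path_sorted. Qed.

Lemma cons_red_reduced l s : reduced s -> reduced (cons_red l s).
Proof.
case: s => [//|l' s] /= rs; case: eqP => [_|/eqP ne]; first exact: path_sorted rs.
by rewrite /reduced /= ne.
Qed.

Lemma reduce_reduced s : reduced (reduce s).
Proof. by elim: s => [//|l s IHs]; apply: cons_red_reduced. Qed.

Lemma reduce_id s : reduced s -> reduce s = s.
Proof.
elim: s => [//|l s IHs] rs /=; rewrite IHs ?(reduced_behead rs) //.
by case: s rs {IHs} => [//|l' s] /= /andP[/negPf-> _].
Qed.

Lemma cons_redK l s : reduced s -> cons_red (invl l) (cons_red l s) = s.
Proof.
case: s => [|l' s] /=; first by rewrite invlK eqxx.
case: eqP => [-> | _] /= rs; last by rewrite invlK eqxx.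
by case: s rs => [//|l'' s] /= /andP[/negPf-> _].
Qed.

Lemma foldr_cons_red_reduced s t :
  reduced t -> reduced (foldr cons_red t s).
Proof. by move=> rt; elim: s => [//|l s IHs]; apply: cons_red_reduced. Qed.

Lemma foldr_reduce s t :
  reduced t -> foldr cons_red t (reduce s) = foldr cons_red t s.
Proof.
move=> rt; elim: s => [//|l s IHs] /=; rewrite -IHs.
case: (reduce s) => [//|l' s'] /=; case: eqP => [->|_] //=.
by have := cons_redK (invl l) (foldr_cons_red_reduced s' rt); rewrite invlK => ->.
Qed.

Lemma reduce_cat s t : reduce (s ++ t) = foldr cons_red (reduce t) s.
Proof. by rewrite /reduce foldr_cat. Qed.

Lemma reduce_catl s t : reduce (reduce s ++ t) = reduce (s ++ t).
Proof. by rewrite !reduce_cat foldr_reduce ?reduce_reduced. Qed.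

Lemma reduce_catr s t : reduce (s ++ reduce t) = reduce (s ++ t).
Proof. by rewrite !reduce_cat reduce_id ?reduce_reduced. Qed.

Definition invw s : seq (letter X) := rev (map (@invl X) s).

Lemma invwK : involutive invw.
Proof.
by move=> s; rewrite /invw map_rev revK -map_comp map_id_in // => l _ /=; exact: invlK.
Qed.

Lemma reduce_invw s : reduce (invw s ++ s) = [::].
Proof.
elim: s => [//|l s IHs]; rewrite /invw /= rev_cons cat_rcons reduce_cat /=.
by rewrite cons_redK ?reduce_reduced // -reduce_cat.
Qed.

End Reduction.

Record freeGroup (X : choiceType) : Type :=
  FreeGroup { fgval :> seq (letter X); fgvalP : reduced fgval }.

Section FreeGroup.
Variable X : choiceType.

HB.instance Definition _ := [isSub for @fgval X].
HB.instance Definition _ := [Choice of freeGroup X by <:].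

Definition word (s : seq (letter X)) : freeGroup X :=
  FreeGroup (reduce_reduced s).

Definition fg_one : freeGroup X := word [::].
Definition fg_mul (v w : freeGroup X) : freeGroup X := word (fgval v ++ fgval w).
Definition fg_inv (w : freeGroup X) : freeGroup X := word (invw (fgval w)).

Lemma fg_mulA : associative fg_mul.
Proof. by move=> u v w; apply: val_inj; rewrite /= reduce_catr reduce_catl catA. Qed.

Lemma fg_mul1 : left_id fg_one fg_mul.
Proof. by move=> w; apply: val_inj; rewrite /= reduce_id ?fgvalP. Qed.

Lemma fg_1mul : right_id fg_one fg_mul.
Proof. by move=> w; apply: val_inj; rewrite /= cats0 reduce_id ?fgvalP. Qed.

Lemma fg_mulV : left_inverse fg_one fg_inv fg_mul.
Proof. by move=> w; apply: val_inj; rewrite /= reduce_catl reduce_invw. Qed.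

Lemma fg_Vmul : right_inverse fg_one fg_inv fg_mul.
Proof.
move=> w; apply: val_inj => /=.
by rewrite reduce_catr -{1}(invwK (fgval w)) reduce_invw.
Qed.

HB.instance Definition _ :=
  isGroup.Build (freeGroup X) fg_mulA fg_mul1 fg_1mul fg_mulV fg_Vmul.

Lemma word_cat (s t : seq (letter X)) : word (s ++ t) = word s * word t.
Proof. by apply: val_inj; rewrite /= reduce_catl reduce_catr. Qed.

End FreeGroup.

Section FreeGroupLift.
Variables (X : choiceType) (H : groupType) (phi : X -> H).

Definition letter_val (l : letter X) : H :=
  if l.2 then (phi l.1)^-1 else phi l.1.

Definition fg_lift (w : freeGroup X) : H := \prod_(l <- fgval w) letter_val l.

Lemma letter_val_invl l : letter_val (invl l) = (letter_val l)^-1.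
Proof. by case: l => x [] /=; rewrite /letter_val /= ?invgK. Qed.

Lemma fg_lift_word s : fg_lift (word s) = \prod_(l <- s) letter_val l.
Proof.
rewrite /fg_lift /=; elim: s => [//|l s IHs] /=; rewrite big_cons -IHs.
case: (reduce s) => [|l' s'] /=; first by rewrite big_cons.
case: eqP => [->|_]; last by rewrite big_cons.
by rewrite big_cons letter_val_invl mulgA mulgV mul1g.
Qed.

Lemma fg_liftM : {morph fg_lift : v w / v * w}.
Proof. by move=> v w; rewrite fg_lift_word big_cat. Qed.

Lemma fg_lift1 : fg_lift 1 = 1.
Proof. by rewrite /fg_lift big_nil. Qed.

HB.instance Definition _ := isUMagmaMorphism.Build (freeGroup X) H fg_lift
  (fg_lift1, fg_liftM).

End FreeGroupLift.

Definition isomorphic (G H : groupType) : Prop :=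
  exists f : {multiplicative G -> H}, bijective f.

Definition is_free (H : groupType) : Prop :=
  exists X : choiceType, isomorphic (freeGroup X) H.

Definition finitely_generated (H : groupType) : Prop :=
  exists (X : finType) (phi : X -> H), forall h, exists w, fg_lift phi w = h.

Definition dirprod (I : finType) (F : I -> groupType) : Type :=
  {dffun forall i : I, F i}.

Section DirectProduct.
Variables (I : finType) (F : I -> groupType).
Implicit Types x y z : dirprod F.

HB.instance Definition _ := Choice.on (dirprod F).

Definition dp_one : dirprod F := [ffun i => 1].
Definition dp_mul x y : dirprod F := [ffun i => x i * y i].
Definition dp_inv x : dirprod F := [ffun i => (x i)^-1].

Lemma dp_mulA : associative dp_mul.
Proof. by move=> x y z; apply/ffunP => i; rewrite !ffunE mulgA. Qed.

Lemma dp_mul1 : left_id dp_one dp_mul.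
Proof. by move=> x; apply/ffunP => i; rewrite !ffunE mul1g. Qed.

Lemma dp_1mul : right_id dp_one dp_mul.
Proof. by move=> x; apply/ffunP => i; rewrite !ffunE mulg1. Qed.

Lemma dp_mulV : left_inverse dp_one dp_inv dp_mul.
Proof. by move=> x; apply/ffunP => i; rewrite !ffunE mulVg. Qed.

Lemma dp_Vmul : right_inverse dp_one dp_inv dp_mul.
Proof. by move=> x; apply/ffunP => i; rewrite !ffunE mulgV. Qed.

HB.instance Definition _ :=
  isGroup.Build (dirprod F) dp_mulA dp_mul1 dp_1mul dp_mulV dp_Vmul.

End DirectProduct.

Definition coabelian (G : groupType) (N : {pred G}) : Prop :=
  exists (m : nat) (f : {multiplicative G -> Algebra.to_multiplicative 'rV[int]_m}),
    (forall z, exists x, f x = z) /\ (forall x, x \in N <-> f x = 1).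

Definition normal_closure (G : groupType) (R : seq G) (w : G) : Prop :=
  forall K : {pred G}, group_closed K ->
    (forall x y, x \in K -> y * x * y^-1 \in K) ->
    {subset R <= K} -> w \in K.

(* A finite presentation < X | R > of H, together with the map X -> H realizing
   the isomorphism between the free group on X modulo R and H. *)
Record finPresentation (H : groupType) : Type := FinPresentation {
  pgen : finType;
  prel : seq (freeGroup pgen);
  pval : pgen -> H;
  pval_surj : forall h : H, exists w, fg_lift pval w = h;
  pval_ker : forall w, fg_lift pval w = 1 <-> normal_closure prel w
}.

Section Dehn.
Variables (H : groupType) (P : finPresentation H).
Implicit Types w : seq (letter (pgen P)).

Definition null_homotopic w : Prop := fg_lift (@pval _ P) (word w) = 1.

Definition conj_product w (k : nat) : Prop :=
  exists u r : 'I_k -> freeGroup (pgen P),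
    (forall i, r i \in prel P \/ (r i)^-1 \in prel P) /\
    word w = \prod_(i < k) (u i * r i * (u i)^-1).

(* The default value 0 is never used on null-homotopic words. *)
Definition area w : nat :=
  if pselect (exists k, `[< conj_product w k >]) is left ex then ex_minn ex
  else 0%N.

Definition dehn (n : nat) : nat :=
  \max_(w : {bseq n of letter (pgen P)} | `[< null_homotopic w >]) area w.

End Dehn.

(* Main.v *)
(** Write [h g] for the l^1-length of the image in Z^m of an element [g] of G.
It is subadditive, so it grows at most linearly along words, and it is
invariant under conjugation.  Call a presentation of a group between N and G
good if every null-homotopic word of length n is a product of at most C^n
conjugates [u r u^-1] of relators with [h u <= C n].

Every finite presentation of G is good: for the standard presentation of a
product of free groups, moving the letters of a word past each other fills it
with quadratically many commutators, conjugated by words of length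
O(n), and changing the presentation only costs constants.

Goodness descends along the chain N = G_0 < G_1 < ... < G_m = G, where G_i is
the preimage of Z^i.  A finite presentation of G_i and a letter [t] for a lift
of the next basis vector give a finite presentation of G_(i+1).  A filling over
it is pushed to G_i by rewriting each conjugate [u r u^-1] at its t-exponent:
a relator sitting at t-exponent [a] becomes the image of a fixed null-homotopic
word under the |a|-th iterate of an endomorphism lifting conjugation by [t], so
it costs K^(|a|+1) relators.  Since |a| <= h u is linear in n this stays
exponential, and since [h] is conjugation invariant the new conjugators still
have linear [h]. *)

From HB Require Import structures.
Require Import Defs.
From mathcomp Require Import all_boot all_order all_algebra.
From mathcomp Require Import boolp reals.

Import Order.TTheory GRing.Theory Num.Theory.

Set Implicit Arguments.
Unset Strict Implicit.
Unset Printing Implicit Defensive.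

Local Open Scope group_scope.

(** * Homomorphisms out of free groups *)

Section FreeGroupMorphisms.
Variable X : choiceType.
Implicit Types (s : seq (letter X)) (w : freeGroup X).

Definition gen (x : X) : freeGroup X := word [:: (x, false)].

Lemma fgvalK w : word (fgval w) = w.
Proof. by apply: val_inj; rewrite /= reduce_id ?fgvalP. Qed.

Lemma word_nil : word [::] = 1 :> freeGroup X.
Proof. by []. Qed.

Lemma word1 (l : letter X) : word [:: l] = letter_val gen l.
Proof. by case: l => x [] //; apply: val_inj. Qed.

Lemma word_cons (l : letter X) s : word (l :: s) = letter_val gen l * word s.
Proof. by rewrite -cat1s word_cat word1. Qed.

Lemma fg_lift_cons (H : groupType) (f : X -> H) l s :
  fg_lift f (word (l :: s)) = letter_val f l * fg_lift f (word s).
Proof. by rewrite !fg_lift_word big_cons. Qed.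

Lemma fg_lift_gen (H : groupType) (f : X -> H) x : fg_lift f (gen x) = f x.
Proof. by rewrite fg_lift_word big_seq1. Qed.

Lemma gmulf_letter (H K : groupType) (g : UMagmaMorphism.type H K) (f : X -> H) l :
  g (letter_val f l) = letter_val (g \o f) l.
Proof. by case: l => x []; rewrite /letter_val /= ?gmulfV. Qed.

Lemma gmulf_lift (H K : groupType) (g : UMagmaMorphism.type H K) (f : X -> H) w :
  g (fg_lift f w) = fg_lift (g \o f) w.
Proof. by rewrite /fg_lift gmulf_prod; apply: eq_bigr => l _; apply: gmulf_letter. Qed.

Lemma eq_fg_lift (H : groupType) (f g : X -> H) :
  f =1 g -> fg_lift f =1 fg_lift g.
Proof.
by move=> fg w; rewrite /fg_lift; apply: eq_bigr => -[x b] _; rewrite /letter_val /= fg.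
Qed.

Lemma fg_lift_id w : fg_lift gen w = w.
Proof.
rewrite -[w]fgvalK; elim: (fgval w) => [|l s IHs]; first by rewrite gmulf1.
by rewrite fg_lift_cons IHs word_cons.
Qed.

Lemma fg_lift_conj (H : groupType) (f : X -> H) u w :
  fg_lift (fun x => u * f x * u^-1) w = u * fg_lift f w * u^-1.
Proof.
rewrite -[w]fgvalK; elim: (fgval w) => [|l s IHs].
  by rewrite !gmulf1 mulg1 mulgV.
rewrite !fg_lift_cons IHs; case: l => x []; rewrite /letter_val /=.
  by rewrite !invgM invgK !mulgA mulgVK.
by rewrite !mulgA mulgVK.
Qed.

End FreeGroupMorphisms.

(* Lengths are measured in G and pulled back to free groups, where they only see
the element represented by a word. *)
Definition class_length (G : groupType) (ht : G -> nat) : Prop :=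
  [/\ ht 1 = 0%N, forall x, ht x^-1 = ht x,
      forall x y, (ht (x * y)%g <= ht x + ht y)%N &
      forall x y, ht (y * x * y^-1) = ht x].

Lemma class_length_comp (E G : groupType) (f : UMagmaMorphism.type E G) ht :
  class_length ht -> class_length (ht \o f).
Proof.
move=> [h1 hV hM hJ]; split=> [|x|x y|x y] /=.
- by rewrite gmulf1.
- by rewrite gmulfV.
- by rewrite gmulfM.
- by rewrite !gmulfM gmulfV.
Qed.

Lemma seq_bound (T : eqType) (Q : nat -> T -> Prop) (s : seq T) :
  (forall K L x, (K <= L)%N -> Q K x -> Q L x) ->
  (forall x, x \in s -> exists K, Q K x) ->
  exists K, forall x, x \in s -> Q K x.
Proof.
move=> Qle; elim: s => [|x s IHs] hs; first by exists 0%N.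
have [K hK] := hs x (mem_head _ _).
have [|L hL] := IHs; first by move=> y ys; apply: hs; rewrite inE ys orbT.
exists (K + L)%N => y; rewrite inE => /predU1P[->|/hL].
  by apply: Qle hK; rewrite leq_addr.
by apply: Qle; rewrite leq_addl.
Qed.

(** * Fillings: products of conjugated relators with controlled conjugators *)

Section Filling.
Variables (E : groupType) (R : seq E) (ht : E -> nat).

(* The base case holds at every [k], so [k] only bounds the number of conjugates. *)
Inductive filling (b : nat) : nat -> E -> Prop :=
| filling1 k : filling b k 1
| filling_cons k u r w : (ht u <= b)%N -> r \in R \/ r^-1 \in R ->
    filling b k w -> filling b k.+1 (u * r * u^-1 * w).

Lemma filling_le b b' k k' w :
  (b <= b')%N -> (k <= k')%N -> filling b k w -> filling b' k' w.
Proof.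
move=> bb' kk' fw; elim: fw k' kk' => {k w} [k|k u r w hu hr _ IHw] [|k'] //.
- by move=> _; apply: filling1.
- by move=> _; apply: filling1.
- by move=> kk'; apply: filling_cons (IHw _ _) => //; apply: leq_trans hu _.
Qed.

Lemma filling_mul b k k' w w' :
  filling b k w -> filling b k' w' -> filling b (k + k') (w * w').
Proof.
move=> fw fw'; elim: fw => {k w} [k|k u r w hu hr _ IHw].
  by rewrite mul1g; apply: filling_le fw' => //; rewrite leq_addl.
by rewrite addSn -mulgA; apply: filling_cons.
Qed.

Hypothesis htP : class_length ht.

Lemma filling_rel b r : r \in R -> filling b 1 r.
Proof.
case: htP => h1 _ _ _ hr; have -> : r = 1 * r * 1^-1 * 1.
  by rewrite mul1g invg1 !mulg1.
by apply: filling_cons; [rewrite h1|left|apply: filling1].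
Qed.

Lemma filling_conj b k u w :
  filling b k w -> filling (ht u + b) k (u * w * u^-1).
Proof.
case: htP => _ _ hM _; elim=> {k w} [k|k v r w hv hr _ IHw].
  by rewrite mulg1 mulgV; apply: filling1.
have -> : u * (v * r * v^-1 * w) * u^-1 =
          (u * v) * r * (u * v)^-1 * (u * w * u^-1).
  by rewrite invgM !mulgA mulgVK.
by apply: filling_cons => //; rewrite (leq_trans (hM _ _)) // leq_add2l.
Qed.

Lemma filling_inv b k w : filling b k w -> filling b k w^-1.
Proof.
elim=> {k w} [k|k u r w hu hr _ IHw]; first by rewrite invg1; apply: filling1.
have -> : (u * r * u^-1 * w)^-1 = w^-1 * (u * r^-1 * u^-1 * 1).
  by rewrite mulg1 !invgM invgK !mulgA.
rewrite -addn1; apply: filling_mul IHw _; apply: filling_cons => //.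
  by rewrite invgK; case: hr; [right|left].
exact: filling1.
Qed.

Lemma filling_bound (T : eqType) (s : seq T) (f : T -> E) :
  (forall x, x \in s -> exists K, filling K K (f x)) ->
  exists K, forall x, x \in s -> filling K K (f x).
Proof. by apply: seq_bound => K L x KL; apply: filling_le. Qed.

(** The elements admitting some filling form a normal subgroup containing [R], so the closure lies
    inside it. *)
Lemma normal_closure_filling w : normal_closure R w -> exists K, filling K K w.
Proof.
move=> /(_ [pred w | `[< exists K, filling K K w >]]) hw.
suff /asboolP : w \in [pred w | `[< exists K, filling K K w >]] by [].
apply: hw.
- split; first by rewrite inE; apply/asboolP; exists 0%N; apply: filling1.
  move=> u v /asboolP[K hK] /asboolP[L hL]; rewrite inE; apply/asboolP.
  exists (K + L)%N; apply: filling_mul.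
    by apply: filling_le hK; rewrite ?leq_addr.
  by apply/filling_inv; apply: filling_le hL; rewrite ?leq_addl.
- move=> u v /asboolP[K hK]; rewrite inE; apply/asboolP.
  exists (ht v + K)%N; apply: filling_le (filling_conj _ hK) => //.
  exact: leq_addl.
- by move=> r hr; rewrite inE; apply/asboolP; exists 1%N; apply: filling_rel.
Qed.

End Filling.

(** Since [f] preserves lengths, only the fillings of the images of relators add to the conjugator
    bound. The count is multiplied but the height merely shifted, so iteration keeps heights
    linear. *)
Lemma filling_morph (E E' : groupType) (R : seq E) (R' : seq E') ht ht' b0 k0
    (f : UMagmaMorphism.type E E') :
  class_length ht' -> (forall u, ht' (f u) = ht u) ->
  (forall r, r \in R -> filling R' ht' b0 k0 (f r)) ->
  forall b k w, filling R ht b k w -> filling R' ht' (b + b0) (k * k0) (f w).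
Proof.
move=> ht'P hf hR b k w; elim=> {k w} [k|k u r w hu hr _ IHw].
  by rewrite gmulf1; apply: filling1.
rewrite mulSn !gmulfM gmulfV; apply: filling_mul IHw.
apply: (@filling_le _ _ _ (ht' (f u) + b0)%N _ k0) => //.
  by rewrite hf leq_add2r.
apply: filling_conj => //; case: hr => [/hR //|/hR].
by rewrite gmulfV => /(filling_inv); rewrite invgK.
Qed.

(* Two homomorphisms from a free group which agree on the generators up to
   null-homotopic elements agree on words up to fillings of linear size. *)
Lemma filling_lift2 (X : finType) (E : groupType) (R : seq E) ht
    (f g : X -> E) :
  class_length ht ->
  (forall x, exists K, filling R ht K K (f x * (g x)^-1)) ->
  exists M, forall s : seq (letter X),
    filling R ht (M * size s) (M * size s)
      (fg_lift f (word s) * (fg_lift g (word s))^-1).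
Proof.
move=> htP fg; have [_ hV hM _] := htP.
have [|K hK] := @filling_bound _ R ht _ (enum {: letter X})
  (fun l => letter_val f l * (letter_val g l)^-1).
  case=> x b _; have [K hK] := fg x; case: b; rewrite /letter_val /=; last by exists K.
  have -> : (f x)^-1 / (g x)^-1 =
     (g x)^-1 * (f x * (g x)^-1)^-1 * (g x)^-1^-1.
    by rewrite invgM !invgK !mulgA mulVg mul1g.
  exists (ht (g x)^-1 + K)%N.
  apply: filling_le (filling_conj htP (g x)^-1 (filling_inv hK)) => //.
  exact: leq_addl.
pose M := (K + \max_(l : letter X) ht (letter_val g l))%N; exists M.
elim=> [|l s IHs]; first by rewrite !gmulf1 invg1 mulg1; apply: filling1.
rewrite !fg_lift_cons /= mulnS; set u := fg_lift f _; set v := fg_lift g _.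
have -> : letter_val f l * u / (letter_val g l * v) =
  (letter_val f l / letter_val g l) * (letter_val g l * (u / v) / letter_val g l).
  by rewrite invgM !mulgA mulgVK.
apply: filling_mul.
  by apply: filling_le (hK l _); rewrite ?mem_enum // /M -?addnA ?leq_addr.
apply: filling_le (filling_conj htP (letter_val g l) IHs) => //.
rewrite leq_add2r /M (leq_trans _ (leq_addl _ _)) //.
by rewrite (leq_bigmax (F := fun l => ht (letter_val g l))).
Qed.

Lemma filling_gmulf1 (E H : groupType) (f : UMagmaMorphism.type E H) R ht b k w :
  (forall r, r \in R -> f r = 1) -> filling R ht b k w -> f w = 1.
Proof.
move=> R1; elim=> {k w} [k|k u r w _ hr _ IHw]; first exact: gmulf1.
have r1 : f r = 1.
  by case: hr => /R1 //; rewrite gmulfV => /(congr1 (@monoid.inv _)); rewrite invgK invg1.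
by rewrite !gmulfM gmulfV IHw r1 !mulg1 mulgV.
Qed.

Lemma mulg_insert (G : groupType) (x y u z : G) :
  x * y * z = x * (y * u^-1) * x^-1 * (x * u * z).
Proof. by rewrite !mulgA !mulgVK. Qed.

(** * Integer powers *)

Section IntegerPowers.
Variable G : groupType.
Implicit Types (t : G) (a : int).

Definition zexpg t a : G :=
  match a with Posz n => t ^+ n | Negz n => t ^- n.+1 end.

Lemma zexpg_succ t a : zexpg t (a + 1)%R = t * zexpg t a.
Proof.
case: a => [n|[|n]].
- by rewrite [(_ + 1)%R]addrC -intS /= expgS.
- by rewrite /= mulgV.
have -> : (Negz n.+1 + 1 = Negz n)%R.
  by rewrite !NegzE (intS n.+1) opprD addrAC addNr add0r.
by rewrite /= [t ^+ n.+2]expgSr invgM mulgA mulgV mul1g.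
Qed.

Lemma zexpg_pred t a : zexpg t (a - 1)%R = t^-1 * zexpg t a.
Proof. by rewrite -{2}[a](subrK 1%R) zexpg_succ mulKg. Qed.

Lemma commute_zexpg t a : commute t (zexpg t a).
Proof.
case: a => n /=; first exact/commuteX/commute_refl.
exact/commuteV/commuteX/commute_refl.
Qed.

End IntegerPowers.

Lemma gmulf_zexpg (G H : groupType) (f : UMagmaMorphism.type G H) t a :
  f (zexpg t a) = zexpg (f t) a.
Proof. by case: a => n /=; rewrite ?gmulfV gmulfXn. Qed.

Lemma additive_zexpg (G : groupType) (chi : G -> int) t a :
  (forall g h, chi (g * h) = (chi g + chi h)%R) ->
  chi (zexpg t a) = (a * chi t)%R.
Proof.
move=> chiM; have chi1 : chi 1 = 0%R.
  by apply: (addrI (chi 1)); rewrite -chiM mulg1 addr0.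
have chiX n : chi (t ^+ n) = (Posz n * chi t)%R.
  elim: n => [|n IHn]; first by rewrite expg0 chi1 mul0r.
  by rewrite expgS chiM IHn intS mulrDl mul1r.
case: a => n; rewrite /zexpg ?NegzE ?mulNr -chiX //.
by apply: (addrI (chi (t ^+ n.+1))); rewrite -chiM mulgV subrr.
Qed.

Lemma class_length_zexpg (G : groupType) (ht : G -> nat) t a :
  class_length ht -> (ht (zexpg t a) <= `|a| * ht t)%N.
Proof.
move=> [h1 hV hM _].
have hX n : (ht (t ^+ n) <= n * ht t)%N.
  elim: n => [|n IHn]; first by rewrite expg0 h1.
  by rewrite expgS mulSn (leq_trans (hM _ _)) // leq_add2l.
by case: a => n /=; rewrite ?hV hX.
Qed.

(** * Presentations of subgroups and exponential fillings *)

Section Presentations.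
Variables (G : groupType) (ht : G -> nat).

(* A presentation of the subgroup [S] of [G]; both generators and lengths live in
[G], so that no intermediate group type is needed. *)
Definition presents (X : finType) (phi : X -> G) (R : seq (freeGroup X))
    (S : G -> Prop) : Prop :=
  [/\ forall g, S g <-> exists w, fg_lift phi w = g,
      forall r, r \in R -> fg_lift phi r = 1 &
      forall w, fg_lift phi w = 1 ->
        exists K, filling R (ht \o fg_lift phi) K K w].

(** This is goodness: one [C] is both the slope of the height bound and the base of the count. *)
Definition exp_fillings (X : finType) (phi : X -> G) (R : seq (freeGroup X)) :
    Prop :=
  exists C, forall s : seq (letter X), fg_lift phi (word s) = 1 ->
    filling R (ht \o fg_lift phi) (C * size s) (C ^ size s) (word s).

End Presentations.

(** * Descent from an extension by an infinite cyclic group to its kernel *)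

Section CyclicExtension.
Variables (G : groupType) (ht : G -> nat).
Hypothesis htP : class_length ht.
Variables (X : finType) (phi : X -> G) (R : seq (freeGroup X)) (S : G -> Prop).
Hypothesis RP : presents ht phi R S.
Variables (t : G) (chi : G -> int) (Pp Pm : X -> freeGroup X).
Hypothesis chiM : forall g h, chi (g * h) = (chi g + chi h)%R.
Hypothesis chit : chi t = 1%R.
Hypothesis chi_phi : forall x, chi (phi x) = 0%R.
Hypothesis chi_ht : forall g, (`|chi g| <= ht g)%N.
Hypothesis PpP : forall x, fg_lift phi (Pp x) = t * phi x * t^-1.
Hypothesis PmP : forall x, fg_lift phi (Pm x) = t^-1 * phi x * t.

Local Notation height := (ht \o fg_lift phi).

Let heightP : class_length height.
Proof. exact: class_length_comp. Qed.

Let chi1 : chi 1 = 0%R.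
Proof. by apply: (addrI (chi 1)); rewrite -chiM mulg1 addr0. Qed.

Let chiV g : chi g^-1 = (- chi g)%R.
Proof. by apply: (addrI (chi g)); rewrite -chiM mulgV subrr. Qed.

Let chi_lift w : chi (fg_lift phi w) = 0%R.
Proof.
rewrite -[w]fgvalK; elim: (fgval w) => [|[x b] s IHs]; first by rewrite gmulf1.
rewrite fg_lift_cons chiM IHs addr0.
by case: b; rewrite /letter_val /= ?chiV chi_phi ?oppr0.
Qed.

Let chi_zexpg a : chi (zexpg t a) = a.
Proof. by rewrite additive_zexpg // chit mulr1. Qed.

Let fg_lift_Pp w : fg_lift phi (fg_lift Pp w) = t * fg_lift phi w * t^-1.
Proof.
by rewrite gmulf_lift -fg_lift_conj; apply: eq_fg_lift => x /=; rewrite PpP.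
Qed.

Let fg_lift_Pm w : fg_lift phi (fg_lift Pm w) = t^-1 * fg_lift phi w * t.
Proof.
rewrite gmulf_lift -[X in _ * X]invgK -fg_lift_conj.
by apply: eq_fg_lift => x /=; rewrite PmP invgK.
Qed.

Definition ext_val (x : option X) : G := if x is Some x then phi x else t.

Definition ext_emb : freeGroup X -> freeGroup (option X) :=
  fg_lift (fun x => gen (Some x)).

HB.instance Definition _ := UMagmaMorphism.copy ext_emb
  (fg_lift (fun x => gen (Some x : option X))).

Definition stable : freeGroup (option X) := gen None.

(** The usual presentation of the semidirect product of [S] with the powers of [t]; the last two
    families move the stable letter and its inverse past a generator. *)
Definition ext_rel : seq (freeGroup (option X)) :=
  map ext_emb R ++
  [seq stable * gen (Some x) * stable^-1 * (ext_emb (Pp x))^-1 | x <- enum X] ++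
  [seq stable^-1 * gen (Some x) * stable * (ext_emb (Pm x))^-1 | x <- enum X].

Local Notation ext_height := (ht \o fg_lift ext_val).

Let ext_heightP : class_length ext_height.
Proof. exact: class_length_comp. Qed.

Lemma ext_val_emb w : fg_lift ext_val (ext_emb w) = fg_lift phi w.
Proof. by rewrite gmulf_lift; apply: eq_fg_lift => x /=; rewrite fg_lift_gen. Qed.

Lemma ext_val_stable : fg_lift ext_val stable = t.
Proof. by rewrite fg_lift_gen. Qed.

Lemma ext_rel1 r : r \in ext_rel -> fg_lift ext_val r = 1.
Proof.
have [_ R1 _] := RP; rewrite !mem_cat => /or3P[] /mapP[x hx ->].
- by rewrite ext_val_emb R1.
- by rewrite !gmulfM !gmulfV /= ext_val_emb PpP ext_val_stable fg_lift_gen mulgV.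
- by rewrite !gmulfM !gmulfV /= ext_val_emb PmP ext_val_stable fg_lift_gen mulgV.
Qed.

Definition ext_null (w : freeGroup (option X)) : Prop :=
  exists K, filling ext_rel ext_height K K w.

Let ext_nullM v w : ext_null v -> ext_null w -> ext_null (v * w).
Proof.
move=> [K hK] [L hL]; exists (K + L)%N; apply: filling_mul.
  by apply: filling_le hK; rewrite ?leq_addr.
by apply: filling_le hL; rewrite ?leq_addl.
Qed.

Let ext_nullJ v w : ext_null w -> ext_null (v * w * v^-1).
Proof.
move=> [K hK]; exists (ext_height v + K)%N.
by apply: filling_le (filling_conj ext_heightP v hK) => //; apply: leq_addl.
Qed.

(** Both sides are homomorphic in [w], so [filling_lift2] reduces the claim to the relators for
    single generators. *)
Let ext_null_stable w :
  ext_null (stable * ext_emb w * stable^-1 * (ext_emb (fg_lift Pp w))^-1).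
Proof.
have [|M hM] := @filling_lift2 X _ ext_rel ext_height
    (fun x => stable * gen (Some x) * stable^-1) (ext_emb \o Pp) ext_heightP.
  move=> x; exists 1%N; apply: filling_rel => //.
  by rewrite !mem_cat; apply/or3P/Or32/mapP; exists x; rewrite ?mem_enum.
exists (M * size (fgval w))%N; have := hM (fgval w).
by rewrite fgvalK fg_lift_conj -gmulf_lift.
Qed.

Let ext_null_stableV w :
  ext_null (stable^-1 * ext_emb w * stable * (ext_emb (fg_lift Pm w))^-1).
Proof.
have [|M hM] := @filling_lift2 X _ ext_rel ext_height
    (fun x => stable^-1 * gen (Some x) * stable^-1^-1) (ext_emb \o Pm) ext_heightP.
  move=> x; exists 1%N; apply: filling_rel => //.
  by rewrite invgK !mem_cat; apply/or3P/Or33/mapP; exists x; rewrite ?mem_enum.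
exists (M * size (fgval w))%N; have := hM (fgval w).
by rewrite fgvalK fg_lift_conj invgK -gmulf_lift.
Qed.

(** Stable letters are collected on the right: prefixing a generator multiplies [v], while prefixing
    a stable letter replaces [v] by its image under [Pp] or [Pm] and shifts [a]. *)
Lemma ext_normal_form w :
  exists v a, ext_null (w * (ext_emb v * zexpg stable a)^-1).
Proof.
rewrite -[w]fgvalK; elim: (fgval w) => [|[x b] s [v [a hva]]].
  exists 1, 0%R; exists 0%N.
  by rewrite gmulf1 /= expg0 mulg1 word_nil; apply: filling1.
set u := ext_emb v * _ in hva; rewrite word_cons.
suff [v' [a' h]] : exists v' a',
    ext_null (letter_val (@gen (option X)) (x, b) * u * (ext_emb v' * zexpg stable a')^-1).
  exists v', a'.
  rewrite (mulg_insert _ (word s) u).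
  exact/ext_nullM/h/ext_nullJ.
case: x => [x|].
  exists (letter_val (@gen X) (x, b) * v), a; exists 0%N.
  rewrite /u gmulfM gmulf_letter.
  set l1 := letter_val _ _; set l2 := letter_val _ _.
  have -> : l2 = l1.
    by rewrite /l1 /l2 /letter_val /=; case: b {l1 l2}; rewrite /ext_emb fg_lift_gen.
  by rewrite mulgA mulgV; apply: filling1.
case: b; rewrite /letter_val /= -/stable.
  exists (fg_lift Pm v), (a - 1)%R; rewrite zexpg_pred.
  by have := ext_null_stableV v; rewrite /u !invgM invgK !mulgA mulgK.
exists (fg_lift Pp v), (a + 1)%R; rewrite zexpg_succ.
by have := ext_null_stable v; rewrite /u !invgM !mulgA mulgK.
Qed.

(** For the kernel: the normal form of a trivial word has exponent zero by [chi], so its remaining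
    part is trivial in [S] and filled by relators of [R]. *)
Lemma ext_presents :
  presents ht ext_val ext_rel (fun g => exists h a, S h /\ g = h * zexpg t a).
Proof.
have [Sim R1 Rker] := RP.
split; [move=> g; split|exact: ext_rel1|].
- move=> [h [a [/Sim[w <-] ->]]]; exists (ext_emb w * zexpg stable a).
  by rewrite gmulfM gmulf_zexpg /= ext_val_emb ext_val_stable.
- move=> [w <-]; have [v [a [K hK]]] := ext_normal_form w.
  exists (fg_lift phi v), a; split; first by apply/Sim; exists v.
  have : fg_lift ext_val (w * (ext_emb v * zexpg stable a)^-1) = 1.
    exact: filling_gmulf1 ext_rel1 hK.
  rewrite gmulfM gmulfV => /divg1_eq ->.
  by rewrite gmulfM gmulf_zexpg /= ext_val_emb ext_val_stable.
move=> w w1; have [v [a h]] := ext_normal_form w.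
have hva : fg_lift phi v * zexpg t a = 1.
  have [K hK] := h.
  have : fg_lift ext_val (w * (ext_emb v * zexpg stable a)^-1) = 1.
    exact: filling_gmulf1 ext_rel1 hK.
  rewrite gmulfM gmulfV /= w1 => /divg1_eq ->.
  by rewrite gmulfM gmulf_zexpg /= ext_val_emb ext_val_stable.
have a0 : a = 0%R by rewrite -(chi_zexpg a) -[LHS]add0r -(chi_lift v) -chiM hva chi1.
move: hva h; rewrite a0 /= mulg1 mulg1 => /Rker[K hK] h.
have -> : w = w * (ext_emb v)^-1 * ext_emb v by rewrite mulgVK.
apply: ext_nullM h _; exists (K + K)%N.
have := @filling_morph _ _ R ext_rel height ext_height 0 1 ext_emb ext_heightP.
move=> /(_ _ _ _ _ _ hK); rewrite addn0 muln1 => hf.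
apply: filling_le (hf _ _); rewrite ?leq_addr //.
  by move=> u; rewrite /= ext_val_emb.
by move=> r hr; apply: filling_rel => //; rewrite mem_cat map_f.
Qed.

(* [Pp] and [Pm] lift conjugation by t and t^-1 but need not be mutually inverse
on the free group, hence the two kinds of iterates. *)
Definition tconj (a : int) (w : freeGroup X) : freeGroup X :=
  match a with
  | Posz n => iter n (fg_lift Pp) w
  | Negz n => iter n.+1 (fg_lift Pm) w
  end.

Lemma tconjM a : {morph tconj a : v w / v * w}.
Proof.
by case: a => n v w /=; [elim: n|rewrite -!iterS; elim: n.+1] => // k /= ->; rewrite gmulfM.
Qed.

Lemma tconj1 a : tconj a 1 = 1.
Proof.
by case: a => n /=; [elim: n|rewrite -!iterS; elim: n.+1] => // k /= ->; rewrite gmulf1.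
Qed.

HB.instance Definition _ a := isUMagmaMorphism.Build (freeGroup X) (freeGroup X)
  (tconj a) (tconj1 a, tconjM a).

Lemma fg_lift_tconj a w :
  fg_lift phi (tconj a w) = zexpg t a * fg_lift phi w * (zexpg t a)^-1.
Proof.
case: a => n; rewrite /tconj /zexpg.
  elim: n => [|n IHn]; first by rewrite expg0 mul1g invg1 mulg1.
  by rewrite iterS fg_lift_Pp IHn expgS invgM !mulgA.
elim: n.+1 => [|k IHk]; first by rewrite expg0 invg1 mul1g invg1 mulg1.
by rewrite iterS fg_lift_Pm IHk expgSr [(_ * t)^-1]invgM invgM !invgK !mulgA.
Qed.

(* The letter t moves the base point a along the line instead of being read. *)
Fixpoint push (a : int) (s : seq (letter (option X))) : freeGroup X :=
  match s with
  | [::] => 1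
  | (Some x, b) :: s' => tconj a (letter_val (@gen X) (x, b)) * push a s'
  | (None, b) :: s' => push (if b then a - 1 else a + 1)%R s'
  end.

(** A stable letter and its inverse return to the base point, and other inverse pairs cancel because
    [tconj a] is a homomorphism; hence [push] descends to the free group. *)
Lemma push_cons_red a l s : push a (cons_red l s) = push a (l :: s).
Proof.
case: s => [//|l' s]; rewrite /cons_red; case: eqP => [->|//].
case: l => [[x|] b] /=; last by case: b => /=; rewrite ?subrK ?addrK.
by rewrite mulgA -tconjM -[(x, ~~ b)]/(invl (x, b)) letter_val_invl mulgV tconj1 mul1g.
Qed.

Lemma push_reduce a s : push a (reduce s) = push a s.
Proof.
elim: s a => [//|l s IHs] a; rewrite [reduce _]/= push_cons_red.
by case: l => [[x|] b] /=; rewrite IHs.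
Qed.

Lemma push_cat a s s' :
  push a (s ++ s') = push a s * push (a + chi (fg_lift ext_val (word s)))%R s'.
Proof.
elim: s a => [|l s IHs] a; first by rewrite gmulf1 chi1 addr0 mul1g.
rewrite fg_lift_cons chiM; case: l => [[x|] b] /=; rewrite IHs.
  have -> : chi (letter_val ext_val (Some x, b)) = 0%R.
    by case: b; rewrite /letter_val /= ?chiV chi_phi ?oppr0.
  by rewrite add0r mulgA.
by case: b; rewrite /letter_val /= ?chiV chit addrA.
Qed.

(** Reidemeister-Schreier rewriting with the powers of [t] as transversal: [s] is read as a path
    from the coset of t^a to the coset where it ends. *)
Lemma push_val a s :
  fg_lift phi (push a s) = zexpg t a * fg_lift ext_val (word s) *
    (zexpg t (a + chi (fg_lift ext_val (word s))))^-1.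
Proof.
elim: s a => [|l s IHs] a.
  by rewrite !gmulf1 chi1 addr0 mulg1 mulgV.
rewrite fg_lift_cons chiM; case: l => [[x|] b] /=.
  have -> : chi (letter_val ext_val (Some x, b)) = 0%R.
    by case: b; rewrite /letter_val /= ?chiV chi_phi ?oppr0.
  rewrite gmulfM /= IHs fg_lift_tconj gmulf_letter add0r !mulgA mulgVK.
  by case: b; rewrite /letter_val /= fg_lift_gen.
rewrite IHs; case: b; rewrite /letter_val /= ?chiV chit addrA.
  by rewrite zexpg_pred -(commuteV (commute_sym (commute_zexpg _ _))) !mulgA.
by rewrite zexpg_succ commute_zexpg !mulgA.
Qed.

Definition pushw a (w : freeGroup (option X)) := push a (fgval w).

Lemma pushw_word a s : pushw a (word s) = push a s.
Proof. exact: push_reduce. Qed.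

Lemma pushwM a v w :
  pushw a (v * w) = pushw a v * pushw (a + chi (fg_lift ext_val v)) w.
Proof. by rewrite -[v]fgvalK -[w]fgvalK -word_cat !pushw_word push_cat. Qed.

Lemma pushw1 a : pushw a 1 = 1.
Proof. by []. Qed.

Lemma pushwV a w :
  pushw (a + chi (fg_lift ext_val w)) w^-1 = (pushw a w)^-1.
Proof. by symmetry; apply: mulg1_eq; rewrite -pushwM mulgV pushw1. Qed.

Lemma pushw_stable a : pushw a stable = 1.
Proof. by rewrite pushw_word. Qed.

Lemma pushw_stableV a : pushw a stable^-1 = 1.
Proof.
rewrite -{1}[a](subrK 1%R) -chit -{2}ext_val_stable pushwV pushw_stable.
by rewrite invg1.
Qed.

Lemma pushw_emb a w : pushw a (ext_emb w) = tconj a w.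
Proof.
rewrite -[w]fgvalK; elim: (fgval w) => [|l s IHs]; first by rewrite !gmulf1.
rewrite word_cons gmulfM pushwM ext_val_emb chi_lift addr0 IHs gmulfM.
congr (_ * _); case: l => x b.
have e : ext_emb (letter_val (gen (X:=X)) (x, b)) = word [:: (Some x, b)].
  by rewrite word1 gmulf_letter; case: b; rewrite /letter_val /= /ext_emb fg_lift_gen.
by rewrite [X in pushw a X]e pushw_word /= mulg1.
Qed.

(* The null-homotopic words whose iterates arise when relators are pushed. *)
Definition tconj_rel : seq (freeGroup X) :=
  R ++ [seq gen x * (fg_lift Pm (Pp x))^-1 | x <- enum X] ++
  [seq gen x * (fg_lift Pp (Pm x))^-1 | x <- enum X].

Lemma tconj_rel1 e : e \in tconj_rel -> fg_lift phi e = 1.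
Proof.
have [_ R1 _] := RP; rewrite !mem_cat => /or3P[/R1 //||] /mapP[x _ ->].
  by rewrite gmulfM gmulfV /= fg_lift_Pm PpP fg_lift_gen !mulgA mulVg mul1g mulgVK mulgV.
by rewrite gmulfM gmulfV /= fg_lift_Pp PmP fg_lift_gen !mulgA mulgV mul1g mulgK mulgV.
Qed.

(** A conjugation relator pushes to a quotient of two iterates. They agree when [a] is zero or on
    the side of the relator's own lift; otherwise an innermost composite of [Pp] and [Pm] remains,
    which gives an iterate of a word of [tconj_rel]. *)
Lemma pushw_rel a r : r \in ext_rel ->
  pushw a r = 1 \/
  exists e n, [/\ e \in tconj_rel, (n <= `|a|)%N &
    pushw a r = iter n (fg_lift Pp) e \/ pushw a r = iter n (fg_lift Pm) e].
Proof.
have iterM P n : {morph iter n (fg_lift P) : v w / v * w^-1 :> freeGroup X}.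
  by move=> v w; elim: n => //= n ->; rewrite gmulfM gmulfV.
rewrite !mem_cat => /or3P[] /mapP[x hx ->].
- right; rewrite pushw_emb; case: a => n.
    by exists x, n; rewrite !mem_cat hx; split=> //; left.
  by exists x, n.+1; rewrite !mem_cat hx; split=> //; right.
- have -> : pushw a (stable * gen (Some x) * stable^-1 * (ext_emb (Pp x))^-1) =
      tconj (a + 1) (gen x) * (tconj a (Pp x))^-1.
    rewrite !pushwM pushw_stable mul1g !gmulfM !gmulfV /= ext_val_stable fg_lift_gen /=.
    rewrite pushw_stableV mulg1 -(PpP x) chi_lift addr0 chit.
    rewrite -[a in pushw a (ext_emb _)^-1](addr0 a) -(chi_lift (Pp x)) -ext_val_emb pushwV.
    rewrite pushw_emb; congr (_ * _).
    by rewrite -pushw_emb /ext_emb fg_lift_gen.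
  case: a => n.
    by left; rewrite addrC -intS /tconj iterSr fg_lift_gen mulgV.
  right; exists (gen x * (fg_lift Pm (Pp x))^-1), n; split=> //.
    by rewrite !mem_cat; apply/or3P/Or32/mapP; exists x.
  right; rewrite iterM -iterSr; congr (_ * _^-1).
  case: n => [//|n].
  have -> // : (Negz n.+1 + 1 = Negz n)%R.
  by rewrite !NegzE (intS n.+1) opprD addrAC addNr add0r.
- have -> : pushw a (stable^-1 * gen (Some x) * stable * (ext_emb (Pm x))^-1) =
      tconj (a - 1) (gen x) * (tconj a (Pm x))^-1.
    rewrite !pushwM pushw_stableV mul1g !gmulfM !gmulfV /= ext_val_stable fg_lift_gen /=.
    rewrite pushw_stable mulg1 -(PmP x) chi_lift addr0 chiV chit.
    rewrite -[a in pushw a (ext_emb _)^-1](addr0 a) -(chi_lift (Pm x)) -ext_val_emb pushwV.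
    rewrite pushw_emb; congr (_ * _).
    by rewrite -pushw_emb /ext_emb fg_lift_gen.
  case: a => [[|n]|n].
  - by left; rewrite sub0r /= fg_lift_gen mulgV.
  - right; exists (gen x * (fg_lift Pp (Pm x))^-1), n; split=> //.
      by rewrite !mem_cat; apply/or3P/Or33/mapP; exists x.
    left; rewrite iterM -iterSr; congr (_ * _^-1).
    by rewrite intS addrAC subrr add0r.
  - left; have -> : (Negz n - 1 = Negz n.+1)%R by rewrite !NegzE (intS n.+1) opprD addrC.
    by rewrite /tconj iterSr fg_lift_gen mulgV.
Qed.

(** [P] lifts a conjugation, so it preserves heights; each application replaces every relator by a
    filling of its image, which multiplies the count by a constant and adds a constant to the
    height. *)
Lemma iter_filling P u e :
  (forall w, fg_lift phi (fg_lift P w) = u * fg_lift phi w * u^-1) ->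
  fg_lift phi e = 1 ->
  exists K, forall n, filling R height (K * n.+1) (K ^ n.+1) (iter n (fg_lift P) e).
Proof.
move=> hP e1; have [_ R1 Rker] := RP; have [_ _ _ htJ] := htP.
have [|K hK] := @filling_bound _ R height _ R (fg_lift P).
  by move=> r hr; apply: Rker; rewrite hP R1 // mulg1 mulgV.
have [L hL] := Rker _ e1; exists (K + L)%N.
elim=> [|n IHn]; first by rewrite muln1 expn1; apply: filling_le hL; rewrite leq_addl.
have h v : height (fg_lift P v) = height v by rewrite /= hP htJ.
rewrite iterS; apply: filling_le (filling_morph heightP h hK IHn).
  by rewrite [in leqRHS]mulnS addnC leq_add2r leq_addr.
by rewrite [in leqRHS]expnSr leq_mul2l leq_addr orbT.
Qed.

(** A conjugator [u] carries its relator to a base point of absolute value at most [b], where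
    [iter_filling] applies. The term [b * ht t] pays for the power of [t] that closes up
    [pushw 0 u]. *)
Lemma pushw_filling : exists2 K, (0 < K)%N & forall b k w,
  filling ext_rel ext_height b k w ->
  filling R height (b + b * ht t + K * b.+1) (k * K ^ b.+1) (pushw 0 w).
Proof.
have Qle K L P (e : freeGroup X) : (K <= L)%N ->
    (forall n, filling R height (K * n.+1) (K ^ n.+1) (iter n (fg_lift P) e)) ->
    (forall n, filling R height (L * n.+1) (L ^ n.+1) (iter n (fg_lift P) e)).
  by move=> KL h n; apply: filling_le (h n); rewrite ?leq_mul2r ?KL ?orbT ?leq_exp2r.
have [K1 hK1] := seq_bound (fun K L e => @Qle K L Pp e)
  (fun e he => iter_filling fg_lift_Pp (tconj_rel1 he)).
have [K2 hK2] := seq_bound (fun K L e => @Qle K L Pm e)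
  (fun e he => @iter_filling Pm t^-1 e
     (fun w => etrans (fg_lift_Pm w) (congr1 _ (esym (invgK t)))) (tconj_rel1 he)).
pose K := (K1 + K2).+1; exists K => //.
have push_rel_filling r a b : r \in ext_rel -> (`|a| <= b)%N ->
    filling R height (K * b.+1) (K ^ b.+1) (pushw a r).
  move=> /(pushw_rel a)[->|[e [n [he na he']]]] ab; first exact: filling1.
  apply: (@filling_le _ _ _ (K * n.+1)%N _ (K ^ n.+1)).
  - by rewrite leq_mul2l ltnS (leq_trans na) ?orbT.
  - by rewrite leq_pexp2l // ltnS (leq_trans na).
  - case: he' => ->; [apply: (Qle _ _ _ _ _ (hK1 e he))|apply: (Qle _ _ _ _ _ (hK2 e he))].
      by rewrite leqW // leq_addr.
    by rewrite leqW // leq_addl.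
move=> b k w; elim=> {k w} [k|k u r w hu hr _ IHw]; first exact: filling1.
set a := chi (fg_lift ext_val u).
have ab : (`|a| <= b)%N by apply: leq_trans (chi_ht _) hu.
have r1 : fg_lift ext_val r = 1.
  case: hr => /ext_rel1 //; rewrite gmulfV => /(congr1 (@monoid.inv _)).
  by rewrite invgK invg1.
(* A relator has t-exponent zero, so [u^-1] starts where [u] ended and retraces it. *)
have -> : pushw 0 (u * r * u^-1 * w) =
    pushw 0 u * pushw a r * (pushw 0 u)^-1 * pushw 0 w.
  rewrite !pushwM add0r !gmulfM !gmulfV /= r1 mulg1 mulgV chi1 addr0.
  by rewrite -(pushwV 0 u) add0r.
rewrite mulSn; apply: filling_mul IHw.
apply: (@filling_le _ _ _ (height (pushw 0 u) + K * b.+1)%N _ (K ^ b.+1)) => //.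
  have [_ htV htM _] := htP.
  rewrite leq_add2r /= push_val mul1g add0r fgvalK (leq_trans (htM _ _)) //.
  by rewrite leq_add // htV (leq_trans (class_length_zexpg _ _ htP)) // leq_mul2r ab orbT.
apply: filling_conj => //; case: hr => hr; first exact: push_rel_filling.
have -> : pushw a r = (pushw a r^-1)^-1.
  by rewrite -pushwV gmulfV /= r1 invg1 chi1 addr0 invgK.
exact/filling_inv/push_rel_filling.
Qed.

(** A word over [X] is filled over the larger alphabet, and the filling is pushed from base point 0,
    where pushing undoes [ext_emb]. *)
Lemma exp_fillings_ext :
  exp_fillings ht ext_val ext_rel -> exp_fillings ht phi R.
Proof.
move=> [C hC]; have [K K0 hK] := pushw_filling.
(* With n the length, the first four summands come from the height bound of [pushw_filling] at
   [b = C * n], the last from C^n K^(C n + 1) being at most (C K^(C+1))^n. Both need n > 0, so the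
   empty word is treated apart. *)
exists (C + C * ht t + K * C + K + C * K ^ C.+1)%N => s s1.
case: s s1 => [|l s']; first by move=> _; apply: filling1.
set s := l :: s'; have : (0 < size s)%N by []; move: s => {l s'} s s0 s1.
pose s' := [seq (Some l.1, l.2) | l <- s].
have ws' : word s' = ext_emb (word s).
  rewrite /s'; elim: (s) => [|[x b] r IHr]; first by rewrite gmulf1.
  rewrite /= !word_cons gmulfM gmulf_letter IHr; congr (_ * _).
  by case: b; rewrite /letter_val /= /ext_emb fg_lift_gen.
have := hC s'; rewrite ws' ext_val_emb size_map => /(_ s1) /hK.
rewrite pushw_emb; apply: filling_le.
  rewrite !mulnDl mulnS; set n := size s in s0 *.
  have -> : (C * n * ht t = C * ht t * n)%N by rewrite mulnAC.
  rewrite -!addnA !leq_add2l addnC mulnA leq_add2l.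
  by rewrite (leq_trans _ (leq_addr _ _)) // leq_pmulr.
apply: (@leq_trans ((C * K ^ C.+1) ^ size s)).
  rewrite expnMn leq_mul2l -expnM; apply/orP; right.
  by rewrite leq_pexp2l // mulSn -add1n leq_add2r.
by rewrite leq_exp2r // leq_addl.
Qed.

End CyclicExtension.

(** * Length in free groups *)

Section ReducedLength.
Variable Y : choiceType.

Lemma size_reduce (s : seq (letter Y)) : (size (reduce s) <= size s)%N.
Proof.
elim: s => //= l s IHs; apply: leq_trans (_ : (size (reduce s)).+1 <= _)%N => //.
by case: (reduce s) => //= l' s'; case: ifP => //= _; rewrite ltnW // ltnW.
Qed.

Lemma size_fgvalM (v w : freeGroup Y) :
  (size (fgval (v * w)%g) <= size (fgval v) + size (fgval w))%N.
Proof. by rewrite -size_cat size_reduce. Qed.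

Lemma size_fg_lift (X : finType) (f : X -> freeGroup Y) :
  exists L, forall s : seq (letter X),
    (size (fgval (fg_lift f (word s))) <= L * size s)%N.
Proof.
pose F l := size (fgval (letter_val f l)); exists (\max_l F l).
elim=> [|l s IHs]; first by rewrite gmulf1.
rewrite fg_lift_cons mulnS (leq_trans (size_fgvalM _ _)) //.
by rewrite leq_add // (leq_bigmax (F := F)).
Qed.

End ReducedLength.

(** * Quadratic fillings in products of free groups *)

Section ProductOfFreeGroups.
Variables (G : groupType) (ht : G -> nat).
Hypothesis htP : class_length ht.
Variables (I Y : finType) (fac : Y -> I) (psi : Y -> G).
Variable rho : I -> UMagmaMorphism.type G (freeGroup Y).
Hypothesis rho_psi : forall i y, rho i (psi y) = if fac y == i then gen y else 1.
Hypothesis psi_comm : forall y z, fac y != fac z -> commute (psi y) (psi z).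

Local Notation height := (ht \o fg_lift psi).
Local Notation lgen := (letter_val (@gen Y)).

Let heightP : class_length height.
Proof. exact: class_length_comp. Qed.

(** Signs are included, so any two letters of different factors swap at the cost of one relator. *)
Definition comm_rel : seq (freeGroup Y) :=
  [seq lgen p.1 * lgen p.2 * (lgen p.1)^-1 * (lgen p.2)^-1
    | p <- enum {: letter Y * letter Y} & fac p.1.1 != fac p.2.1].

Lemma comm_rel1 r : r \in comm_rel -> fg_lift psi r = 1.
Proof.
move=> /mapP[[[y b] [z c]]]; rewrite mem_filter /= => /andP[/psi_comm yz _] ->.
rewrite !gmulfM !gmulfV !gmulf_letter /letter_val /= !fg_lift_gen.
have yzV := commuteV yz; have yVz := commute_sym (commuteV (commute_sym yz)).
have yVzV := commuteV yVz.
by case: b; case: c; rewrite ?yz ?yVz ?yzV ?yVzV mulgK mulgV.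
Qed.

Definition factor (i : I) (s : seq (letter Y)) : freeGroup Y :=
  word [seq l <- s | fac l.1 == i].

Lemma factor_cons i l s :
  factor i (l :: s) = if fac l.1 == i then lgen l * factor i s else factor i s.
Proof. by rewrite {1}/factor /=; case: (fac l.1 == i); rewrite ?word_cons. Qed.

(** [rho i] kills the letters of the other factors; a word trivial in [G] thus has each [factor i s]
    trivial in the free group. *)
Lemma rho_word i s : rho i (fg_lift psi (word s)) = factor i s.
Proof.
elim: s => [|[y b] s IHs]; first by rewrite !gmulf1.
rewrite fg_lift_cons gmulfM IHs gmulf_letter factor_cons /letter_val /= rho_psi.
by case: (fac y == i) => //; case: b; rewrite ?invg1 mul1g.
Qed.

Let H := \max_(l : letter Y) height (lgen l).

Let height_letter l : (height (lgen l) <= H)%N.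
Proof. exact: (leq_bigmax (F := fun l => height (lgen l))). Qed.

Let height_word s : (height (word s) <= H * size s)%N.
Proof.
have [h1 _ hM _] := heightP.
elim: s => [|l s IHs]; first by rewrite word_nil h1.
by rewrite word_cons mulnS (leq_trans (hM _ _)) // leq_add.
Qed.

Lemma comm_filling l s : all (fun m => fac l.1 != fac m.1) s ->
  filling comm_rel height (H * size s) (size s)
    (lgen l * word s * (lgen l)^-1 * (word s)^-1).
Proof.
elim: s => [_|m s IHs /= /andP[lm /IHs hs]].
  by rewrite word_nil invg1 !mulg1 mulgV; apply: filling1.
rewrite word_cons; set a := lgen l in hs *; set b := lgen m; set v := word s in hs *.
have -> : a * (b * v) * a^-1 * (b * v)^-1 =
    a * b * a^-1 * b^-1 * (b * (a * v * a^-1 * v^-1) * b^-1).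
  by rewrite invgM !mulgA !mulgVK.
rewrite -add1n mulnS; apply: filling_mul.
  apply: filling_rel => //; apply/mapP; exists (l, m) => //.
  by rewrite mem_filter mem_enum lm.
apply: filling_le (filling_conj heightP b hs) => //.
by rewrite leq_add2r height_letter.
Qed.

(** A new leading letter travels past the subwords of the factors listed before its own, each of
    length at most [size s]. *)
Lemma factor_filling l s (r : seq I) : uniq r -> fac l.1 \in r ->
  filling comm_rel height (H * size s * size r) (size s * size r)
    (lgen l * \prod_(i <- r) factor i s * (\prod_(i <- r) factor i (l :: s))^-1).
Proof.
elim: r => // i r IHr /= /andP[ir /IHr{}IHr]; rewrite inE !big_cons factor_cons.
have [li _|li /IHr hr] := eqVneq (fac l.1) i.
  (* The letter has reached its own factor; since the list is duplicate-free, the later subwords do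
     not change. *)
  have -> : \prod_(j <- r) factor j (l :: s) = \prod_(j <- r) factor j s.
    rewrite !big_seq; apply: eq_bigr => j jr; rewrite factor_cons ifN // li.
    by apply: contraNneq ir => ->.
  by rewrite mulgA mulgV; apply: filling1.
pose s' := [seq m <- s | fac m.1 == i].
have ss' : (size s' <= size s)%N by rewrite size_filter count_size.
rewrite invgM (mulgA (lgen l)).
set A := factor i s; set B := \prod_(j <- r) _ in hr *; set B' := \prod_(j <- r) _ in hr *.
have -> : lgen l * A * B * (B'^-1 * A^-1) =
    lgen l * A * (lgen l)^-1 * A^-1 * (A * (lgen l * B * B'^-1) * A^-1).
  by rewrite !mulgA !mulgVK.
rewrite !mulnS; apply: filling_mul.
  apply: filling_le (comm_filling (_ : all _ s')) => //.
    by rewrite (leq_trans _ (leq_addr _ _)) // leq_mul2l ss' orbT.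
  by apply/allP => m; rewrite mem_filter => /andP[/eqP-> _].
apply: filling_le (filling_conj heightP A hr) => //.
by rewrite leq_add2r (leq_trans (height_word s')) // leq_mul2l ss' orbT.
Qed.

(** Letters are sorted into factors from the end of the word, each at linear cost; the sorted word
    is trivial by [rho_word]. *)
Lemma prod_filling s : fg_lift psi (word s) = 1 ->
  filling comm_rel height (H * #|I|.+1 * size s) (#|I| * size s ^ 2) (word s).
Proof.
move=> s1.
suff : filling comm_rel height (H * #|I|.+1 * size s) (#|I| * size s ^ 2)
    (word s * (\prod_(i <- enum I) factor i s)^-1).
  by rewrite big1 ?invg1 ?mulg1 // => i _; rewrite -rho_word s1 gmulf1.
elim: s {s1} => [|l s IHs].
  by rewrite big1 ?mulgV //; apply: filling1.
rewrite word_cons (mulg_insert _ _ (\prod_(i <- enum I) factor i s)).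
have hl := @factor_filling l s (enum I) (enum_uniq _) (mem_enum _ _).
apply: (@filling_le _ _ _ (H * #|I|.+1 * size s + H) _
         (#|I| * size s ^ 2 + size s * #|I|)).
- by rewrite (mulnS _ (size s)) addnC leq_add2r leq_pmulr.
- rewrite (mulnC (size s)) -mulnDr leq_mul2l -!mulnn (mulSn (size s)) mulnS.
  by rewrite [(_ * _ + size s)%N]addnC leq_addl orbT.
apply: filling_mul.
  by apply: filling_le (filling_conj heightP _ IHs) => //; rewrite addnC leq_add2l.
apply: filling_le hl; rewrite -?cardE //.
by rewrite (leq_trans _ (leq_addr _ _)) // mulnAC -!mulnA leq_mul2l leq_mul2r leqnSn !orbT.
Qed.

(** Change of generators: a word is translated to [Y] by [alpha], filled there by commutators and
    translated back by [beta]; [M] accounts for the difference from the original word. *)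
Lemma prod_exp_fillings (X : finType) (phi : X -> G) (R : seq (freeGroup X)) S :
  presents ht phi R S -> (forall y, S (psi y)) ->
  (forall x, exists w, fg_lift psi w = phi x) ->
  exp_fillings ht phi R.
Proof.
move=> [Sim R1 Rker] psiS /fin_all_exists[alpha alphaP].
have /fin_all_exists[beta betaP] : forall y, exists w, fg_lift phi w = psi y.
  by move=> y; apply/Sim.
have phi_beta w : fg_lift phi (fg_lift beta w) = fg_lift psi w.
  by rewrite gmulf_lift; apply: eq_fg_lift => y /=.
have psi_alpha w : fg_lift psi (fg_lift alpha w) = fg_lift phi w.
  by rewrite gmulf_lift; apply: eq_fg_lift => x /=.
have phiP : class_length (ht \o fg_lift phi) by apply: class_length_comp.
have [|M hM] := @filling_lift2 X _ R (ht \o fg_lift phi) (@gen X)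
    (fg_lift beta \o alpha) phiP.
  move=> x; apply: Rker.
  by rewrite gmulfM gmulfV /= phi_beta alphaP fg_lift_gen mulgV.
have [|K hK] := @filling_bound _ R (ht \o fg_lift phi) _ comm_rel (fg_lift beta).
  by move=> r /comm_rel1 r1; apply: Rker; rewrite phi_beta.
have [L hL] := size_fg_lift alpha.
(* The count is at most Q n^2, hence at most (4 Q)^n for n > 0, as n^2 <= 4^n. *)
pose Q := (M + #|I| * L ^ 2 * K)%N.
exists (M + H * #|I|.+1 * L + K + Q * 4)%N => -[_|l s']; first exact: filling1.
set s := l :: s'; have : (0 < size s)%N by []; move: s => {l s'} s s0 s1.
have := hM s; rewrite fg_lift_id -gmulf_lift => hs.
set v := fg_lift alpha (word s) in hs; have {hL} := hL s; rewrite -/v => hL.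
have := @prod_filling (fgval v); rewrite fgvalK psi_alpha => /(_ s1) hv.
have {}hv := filling_morph phiP (fun u => congr1 ht (phi_beta u)) hK hv.
rewrite -[word s](mulgVK (fg_lift beta v)).
set n := size s in s0 hs hL *; set m := size (fgval v) in hL hv.
apply: (@filling_le _ _ _ (M * n + (H * #|I|.+1 * m + K)) _
         (M * n + #|I| * m ^ 2 * K)).
- rewrite !mulnDl -!addnA leq_add2l leq_add //.
    by rewrite -[in leqRHS]mulnA leq_mul2l hL orbT.
  by rewrite (leq_trans _ (leq_addr _ _)) // leq_pmulr.
- apply: (@leq_trans (Q * n ^ 2)).
    rewrite mulnDl leq_add //; first by rewrite leq_mul2l -mulnn leq_pmulr ?orbT.
    rewrite [in leqRHS]mulnAC leq_mul2r -mulnA leq_mul2l -expnMn leq_exp2r //.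
    by rewrite hL !orbT.
  apply: (@leq_trans ((Q * 4) ^ n)); last by rewrite leq_exp2r // leq_addl.
  rewrite expnMn leq_mul //; last first.
    by rewrite -[4]/(2 ^ 2)%N -expnM mulnC expnM leq_exp2r // ltnW // ltn_expl.
  by case: (Q) => // q; rewrite -{1}[q.+1]expn1 leq_pexp2l.
apply: filling_mul; first by apply: filling_le hs; rewrite ?leq_addr.
by apply: filling_le hv; rewrite ?leq_addl.
Qed.

End ProductOfFreeGroups.

(** * Finite bases of the factors and coordinates on the product *)

Lemma morph_gmulf1 (G H : groupType) (f : G -> H) :
  {morph f : x y / x * y} -> f 1 = 1.
Proof. by move=> fM; apply: (mulgI (f 1)); rewrite -fM !mulg1. Qed.

Definition umorph (G H : groupType) (f : G -> H) (fM : {morph f : x y / x * y}) :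
    UMagmaMorphism.type G H :=
  HB.pack f (isUMagmaMorphism.Build G H f (morph_gmulf1 fM, fM)).

(** A finite generating set involves only finitely many basis letters, collected in [Z]; these
    already generate, and killing the others gives [r]. *)
Lemma free_fg_basis (H : groupType) : is_free H -> finitely_generated H ->
  exists (X : finType) (b : X -> H) (r : UMagmaMorphism.type H (freeGroup X)),
    (forall x, r (b x) = gen x) /\ (forall h, exists w, fg_lift b w = h).
Proof.
move=> [X0 [f0 [g f0K gf0K]]] [A [phi phi_surj]].
have [f fE] : exists f : UMagmaMorphism.type (freeGroup X0) H, f =1 f0.
  by exists (umorph (@gmulfM _ _ f0)).
have fK : cancel f g by move=> x; rewrite fE f0K.
have gK : cancel g f by move=> x; rewrite fE gf0K.
have gM : {morph g : x y / x * y} := can2_gmulfM fK gK.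
pose Z : seq X0 := flatten [seq [seq l.1 | l <- fgval (g (phi a))] | a <- enum A].
pose X : finType := seq_sub Z.
pose b (x : X) : H := f (gen (val x)).
pose r0 (x : X0) : freeGroup X := if insub x is Some y then gen (y : X) else 1.
have rM : {morph (fun h => fg_lift r0 (g h)) : x y / x * y}.
  by move=> x y; rewrite gM gmulfM.
exists X, b, (umorph rM); split=> [x|h].
  by rewrite /= fK fg_lift_gen /r0 valK.
have bP (s : seq (letter X0)) : all (fun l => l.1 \in Z) s ->
    exists w, fg_lift b w = f (word s).
  elim: s => [_|[x p] s IHs /= /andP[xZ /IHs[w hw]]].
    by exists 1; rewrite word_nil !gmulf1.
  exists (letter_val (@gen X) (SeqSub xZ, p) * w).
  rewrite word_cons !gmulfM !gmulf_letter /= hw; congr (_ * _).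
  by case: p; rewrite /letter_val /= fg_lift_gen.
have /fin_all_exists[alpha alphaP] : forall a, exists w, fg_lift b w = phi a.
  move=> a; have [|w hw] := bP (fgval (g (phi a))); last by exists w; rewrite hw fgvalK gK.
  apply/allP => l hl; apply/flattenP; exists [seq l.1 | l <- fgval (g (phi a))].
    by apply/mapP; exists a; rewrite ?mem_enum.
  exact: map_f.
have [w <-] := phi_surj h; exists (fg_lift alpha w).
by rewrite gmulf_lift; apply: eq_fg_lift => a /=.
Qed.

Section DirectProductInjections.
Variables (I : finType) (F : I -> groupType).

Definition dp_inj i (h : F i) : dirprod F :=
  [ffun j => dfwith (fun k => 1 : F k) h j].

Lemma dp_injE i (h : F i) : dp_inj h i = h.
Proof. by rewrite ffunE dfwith_in. Qed.

Lemma dp_inj_out i (h : F i) j : i != j -> dp_inj h j = 1.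
Proof. by move=> ij; rewrite ffunE dfwith_out. Qed.

Lemma dp_injM i : {morph @dp_inj i : x y / x * y}.
Proof.
move=> x y; apply/ffunP => j; rewrite [RHS]ffunE.
have [<-|ij] := eqVneq i j; first by rewrite !dp_injE.
by rewrite !dp_inj_out // mulg1.
Qed.

Lemma dp_inj_commute i j (x : F i) (y : F j) :
  i != j -> commute (dp_inj x) (dp_inj y).
Proof.
move=> ij; apply/ffunP => k; rewrite ![LHS]ffunE ![RHS]ffunE.
have [ik|ik] := eqVneq i k; last by rewrite (dp_inj_out x ik) mulg1 mul1g.
by rewrite (dp_inj_out y) ?mulg1 ?mul1g // -ik eq_sym.
Qed.

Lemma dirprod_prod (x : dirprod F) : x = \prod_(i <- enum I) dp_inj (x i).
Proof.
apply/ffunP => j.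
have : forall r : seq I, uniq r ->
    (\prod_(i <- r) dp_inj (x i)) j = if j \in r then x j else 1.
  elim=> [_|i r IHr /= /andP[ir /IHr{}IHr]]; first by rewrite big_nil ffunE.
  rewrite big_cons [LHS]ffunE IHr inE.
  have [ji|ij] := eqVneq j i; first by subst i; rewrite (negPf ir) mulg1 dp_injE.
  by rewrite dp_inj_out 1?eq_sym // mul1g.
by move=> /(_ _ (enum_uniq I)) ->; rewrite mem_enum.
Qed.

End DirectProductInjections.

(** [Y] is the disjoint union of finite bases of the factors; [rho i] projects to a factor and then
    includes its alphabet in [Y]. *)
Lemma free_product_generators (I : finType) (F : I -> groupType) (G : groupType) :
  (forall i, is_free (F i)) -> (forall i, finitely_generated (F i)) ->
  isomorphic G (dirprod F) ->
  exists (Y : finType) (fac : Y -> I) (psi : Y -> G)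
         (rho : I -> UMagmaMorphism.type G (freeGroup Y)),
    [/\ forall i y, rho i (psi y) = if fac y == i then gen y else 1,
        forall y z, fac y != fac z -> commute (psi y) (psi z) &
        forall g, exists w, fg_lift psi w = g].
Proof.
move=> hfree hfg [e [e' eK e'K]].
have /fin_all_exists[X /fin_all_exists[b /fin_all_exists[r rP]]] :=
  fun i => free_fg_basis (hfree i) (hfg i).
have e'M : {morph e' : x y / x * y} := can2_gmulfM eK e'K.
pose Y : finType := {i : I & X i}.
pose psi (y : Y) : G := e' (dp_inj (b (tag y) (tagged y))).
pose rho0 i (g : G) : freeGroup Y :=
  fg_lift (fun x => gen (Tagged X x : Y)) (r i (e g i)).
have rhoM i : {morph rho0 i : x y / x * y}.
  by move=> x y; rewrite /rho0 gmulfM [(_ * _ : dirprod F) i]ffunE !gmulfM.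
exists Y, tag, psi, (fun i => umorph (rhoM i)); split.
- move=> i [j x]; rewrite /= /rho0 /psi e'K /=.
  have [<-|ji] := eqVneq j i; last by rewrite dp_inj_out // !gmulf1.
  by rewrite dp_injE (rP j).1 fg_lift_gen.
- by move=> y z yz; rewrite /psi /commute -!e'M dp_inj_commute.
- move=> g; rewrite -[g]eK [e g]dirprod_prod; elim: (enum I) => [|i s [w hw]].
    by exists 1; rewrite big_nil gmulf1 (morph_gmulf1 e'M).
  have [v hv] := (rP i).2 (e g i).
  exists (fg_lift (fun x => gen (Tagged X x : Y)) v * w).
  rewrite gmulfM /= hw big_cons e'M -hv; congr (_ * _).
  have hM : {morph (fun x : F i => e' (dp_inj x)) : x y / x * y}.
    by move=> x y; rewrite dp_injM e'M.
  rewrite -[RHS]/(umorph hM _) !gmulf_lift; apply: eq_fg_lift => x /=.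
  by rewrite fg_lift_gen.
Qed.

Lemma presents_ext (G : groupType) ht (X : finType) (phi : X -> G) R S S' :
  (forall g, S g <-> S' g) -> presents ht phi R S -> presents ht phi R S'.
Proof.
by move=> SS' [Sim R1 Rker]; split=> // g; rewrite -SS'.
Qed.

(** * From fillings to area *)

Lemma filling_conj_product (H : groupType) (P : finPresentation H) ht b k w :
  filling (prel P) ht b k (word w) ->
  exists2 k', (k' <= k)%N & conj_product w k'.
Proof.
rewrite /conj_product; elim=> {k} [k|k u r v _ hr _ [k' kk' [us [rs [hrs ->]]]]].
  exists 0%N => //; exists (fun=> 1), (fun=> 1).
  by split=> [[]//|]; rewrite big_ord0.
exists k'.+1 => //.
exists (fun i => if unlift ord0 i is Some j then us j else u),
       (fun i => if unlift ord0 i is Some j then rs j else r); split.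
  by move=> i; case: unliftP => [j|] _.
rewrite big_ord_recl unlift_none; congr (_ * _).
by apply: eq_bigr => i _; rewrite liftK.
Qed.

Lemma area_filling (H : groupType) (P : finPresentation H) ht b k w :
  filling (prel P) ht b k (word w) -> (area w <= k)%N.
Proof.
move=> /filling_conj_product[k' kk' hk']; rewrite /area.
case: pselect => [ex|//]; case: ex_minnP => n _ /(_ k').
by move=> /(_ (asboolT hk')) /leq_trans; apply.
Qed.

(** * Descent along the chain of coordinate subgroups *)

Section CoabelianLength.
Variables (G : groupType) (m : nat) (chi : 'I_m -> G -> int).
Hypothesis chiM : forall j g h, chi j (g * h) = (chi j g + chi j h)%R.

Definition sum_length (g : G) : nat := \sum_j `|chi j g|.

Let chi1 j : chi j 1 = 0%R.
Proof. by apply: (addrI (chi j 1)); rewrite -chiM mulg1 addr0. Qed.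

Let chiV j g : chi j g^-1 = (- chi j g)%R.
Proof. by apply: (addrI (chi j g)); rewrite -chiM mulgV subrr. Qed.

Let chiJ j g h : chi j (h * g * h^-1) = chi j g.
Proof. by rewrite !chiM chiV addrAC subrr add0r. Qed.

Lemma sum_length_class : class_length sum_length.
Proof.
split=> [|g|g h|g h]; rewrite /sum_length.
- by rewrite big1 // => j _; rewrite chi1.
- by apply: eq_bigr => j _; rewrite chiV abszN.
- rewrite -big_split /= leq_sum // => j _; rewrite chiM.
  by rewrite -lez_nat PoszD !abszE ler_normD.
- by apply: eq_bigr => j _; rewrite chiJ.
Qed.

Lemma sum_length_ge j g : (`|chi j g| <= sum_length g)%N.
Proof. by rewrite /sum_length (bigD1 j) //= leq_addr. Qed.

(** The subgroup G_i of the chain: G_0 is the common kernel of all coordinates and G_m is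
    everything. *)
Definition vanish_from (i : nat) (g : G) : Prop :=
  forall j : 'I_m, (i <= j)%N -> chi j g = 0%R.

Hypothesis chi_basis : forall j, exists t, forall k, chi k t = (k == j)%:R%R.
Hypothesis G_exp : forall (X : finType) (phi : X -> G) (R : seq (freeGroup X)),
  presents sum_length phi R (fun=> True) -> exp_fillings sum_length phi R.

(** Induction on [m - i], starting from [G] itself, where [G_exp] applies; each step adjoins a lift
    [t] of the next basis vector. *)
Lemma coabelian_exp_fillings i : (i <= m)%N ->
  forall (X : finType) (phi : X -> G) (R : seq (freeGroup X)),
  presents sum_length phi R (vanish_from i) -> exp_fillings sum_length phi R.
Proof.
move=> im; have [k mk] : exists k, (m = i + k)%N by exists (m - i)%N; rewrite subnKC.
elim: k i im mk => [|k IHk] i im mk X phi R RP.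
  apply: G_exp; apply: presents_ext RP => g; split=> // _ j.
  by rewrite leqNgt (leq_trans (ltn_ord j)) // mk addn0.
have i_lt_m : (i < m)%N by rewrite mk -addSnnS leq_addr.
pose j := Ordinal i_lt_m; have [t tP] := chi_basis j.
have [Sim _ _] := RP.
have chi_phi (l : 'I_m) x : (i <= l)%N -> chi l (phi x) = 0%R.
  by move=> il; have /(_ l il) : vanish_from i (phi x) by apply/Sim; exists (gen x); rewrite fg_lift_gen.
have /fin_all_exists[Pp PpP] : forall x, exists w, fg_lift phi w = t * phi x * t^-1.
  by move=> x; apply/Sim => l il; rewrite chiJ chi_phi.
have /fin_all_exists[Pm PmP] : forall x, exists w, fg_lift phi w = t^-1 * phi x * t.
  by move=> x; apply/Sim => l il; rewrite -[X in _ * X]invgK chiJ chi_phi.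
have chit : chi j t = 1%R by rewrite tP eqxx.
have chi_phij x : chi j (phi x) = 0%R by apply: chi_phi.
have := ext_presents sum_length_class RP (chiM j) chit chi_phij PpP PmP.
move=> extP; apply: (exp_fillings_ext sum_length_class RP (chiM j) chit chi_phij
  (sum_length_ge j) PpP PmP).
apply: (IHk i.+1) => //; first by rewrite mk addSnnS.
apply: presents_ext extP => g; split.
  move=> [h [a [hh ->]]] l il; rewrite chiM hh ?(ltnW il) // add0r.
  rewrite additive_zexpg // tP; case: eqP => [lj|_]; last by rewrite mulr0.
  by rewrite lj ltnn in il.
(* Dividing by this power of [t] removes coordinate [j] and leaves the others unchanged, as [t]
   lifts a basis vector. *)
move=> hg; exists (g * (zexpg t (chi j g))^-1), (chi j g); split; last by rewrite mulgVK.
move=> l; rewrite leq_eqVlt chiM chiV additive_zexpg // tP => /orP[/eqP il|il].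
  have -> : l = j by apply: val_inj.
  by rewrite eqxx mulr1 subrr.
by rewrite hg // -val_eqE /= gtn_eqF // mulr0 subr0.
Qed.

End CoabelianLength.

(** * Exponential bound for the Dehn function *)

Theorem corollary1p4 (R : realType) (I : finType) (F : I -> groupType)
    (hfree : forall i, is_free (F i))
    (hfg : forall i, finitely_generated (F i))
    (G : groupType) (hG : isomorphic G (dirprod F))
    (S : {pred G}) (N : subGroupType S) (hN : coabelian S)
    (P : finPresentation N) :
  exists C : R, (1 < C)%R /\ forall n : nat, ((dehn P n)%:R <= C ^+ n)%R.
Proof.
have [m [f [f_surj fS]]] := hN.
pose chi (j : 'I_m) (g : G) : int := (f g : 'rV[int]_m) ord0 j.
have chiM j g h : chi j (g * h) = (chi j g + chi j h)%R.
  by rewrite /chi gmulfM -[LHS]/((f g + f h : 'rV[int]_m)%R ord0 j) mxE.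
have chi_basis j : exists t, forall k, chi k t = (k == j)%:R%R.
  have [t ft] := f_surj (delta_mx ord0 j : 'rV[int]_m).
  by exists t => k; rewrite /chi ft mxE eqxx.
have htP := sum_length_class chiM.
have G_exp (X : finType) (phi : X -> G) (Q : seq (freeGroup X)) :
    presents (sum_length chi) phi Q (fun=> True) -> exp_fillings (sum_length chi) phi Q.
  have [Y [fac [psi [rho [h1 h2 h3]]]]] := free_product_generators hfree hfg hG.
  by move=> QP; apply: (prod_exp_fillings htP h1 h2 QP).
pose phi x : G := val (@pval _ P x).
have phiE w : fg_lift phi w = val (fg_lift (@pval _ P) w).
  by rewrite (gmulf_lift (val : UMagmaMorphism.type N G)).
have PP : presents (sum_length chi) phi (prel P) (vanish_from chi 0).
  split.
  - move=> g; split=> [g0|[w <-]].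
      have gS : g \in S.
        apply/fS; apply: (_ : (f g : 'rV[int]_m) = 0%R).
        by apply/rowP => j; rewrite mxE -[RHS](g0 j).
      have [w hw] := pval_surj P (Sub g gS : N).
      by exists w; rewrite phiE hw SubK.
    move=> j _; rewrite phiE /chi; have /fS -> := valP (fg_lift (@pval _ P) w).
    by rewrite -[LHS]/((0 : 'rV[int]_m)%R ord0 j) mxE.
  - move=> r hr; rewrite phiE; have -> : fg_lift (@pval _ P) r = 1; last exact: val1.
    by apply/pval_ker => K _ _; apply.
  - move=> w; rewrite phiE -[X in _ = X](val1 N) => /val_inj /pval_ker.
    exact/normal_closure_filling/class_length_comp.
have [C hC] := coabelian_exp_fillings chiM chi_basis G_exp (leq0n m) PP.
(* Adding 2 makes the base exceed 1 even if [C] is 0, so its powers grow from [size w] to [n]. *)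
exists C.+2%:R%R; split; first by rewrite ltr1n.
move=> n; rewrite -natrX ler_nat /dehn; apply/bigmax_leqP => w /asboolP w1.
have := hC w; rewrite phiE w1 => /(_ (val1 N)) /area_filling/leq_trans; apply.
apply: (@leq_trans (C.+2 ^ size w)); last by rewrite leq_pexp2l // size_bseq.
by case: (size w) => // k; rewrite leq_exp2r // ltnW.
Qed.
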